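(* Let $A$ be a finite alphabet and let $F: A^{\mathbb N}\to A^{\mathbb N}$ be a dill map with diameter $\theta$ and local rule $f: A^\theta\to A^*$. If $1<|f|$, where $|f|=\min\{|f(u)| : u\in A^\theta\}$, then $F$ is equicontinuous (with respect to the Cantor distance on $A^{\mathbb N}$).
   Context: An alphabet $A$ is a finite set; $\mathbb N=\{0,1,2,\dots\}$. $A^\theta$ is the set of words of length $\theta$ over $A$, $A^*$ the set of all finite words (including the empty word), $|u|$ the length of a word $u$, and $A^{\mathbb N}$ the set of one-sided infinite sequences. For $x\in A^{\mathbb N}$, $x_{[i,j)}$ denotes the word $x_i x_{i+1}\cdots x_{j-1}$. A dill map over $A^{\mathbb N}$ is a function $F:A^{\mathbb N}\to A^{\mathbb N}$ for which there exist an integer $\theta>0$ (the diameter) and a map $f:A^\theta\to A^*$ (the local rule) such that for all $x\in A^{\mathbb N}$, $F(x)=f(x_{[0,\theta)})\,f(x_{[1,1+\theta)})\,f(x_{[2,2+\theta)})\cdots$ (infinite concatenation). The lower norm of $F$ is $|f|=\min\{|f(u)| : u\in A^\theta\}$. The Cantor distance on $A^{\mathbb N}$ is $d_C(x,y)=2^{-\min\{i\in\mathbb N : x_i\neq y_i\}}$ if $x\neq y$, and $d_C(x,x)=0$. The map $F$ is equicontinuous if for every $\varepsilon>0$ there exists $\delta>0$ such that for all $x,y\in A^{\mathbb N}$, $d_C(x,y)<\delta$ implies $d_C(F^t(x),F^t(y))<\varepsilon$ for all $t\in\mathbb N$. *)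

(* Defs.v *)
From HB Require Import structures.
From mathcomp Require Import all_boot all_order all_algebra.
From mathcomp Require Import boolp reals.

Set Implicit Arguments.
Unset Strict Implicit.
Unset Printing Implicit Defensive.

Import Order.TTheory GRing.Theory Num.Theory.

Local Open Scope ring_scope.

Section DillMaps.
Variable A : finType.
Implicit Types (x y : nat -> A) (F : (nat -> A) -> (nat -> A)).

(* The word x_[i, i + theta) *)
Definition factor (theta : nat) x (i : nat) : theta.-tuple A :=
  [tuple x (i + k)%N | k < theta].

(* y = w 0 w 1 w 2 ...: every finite concatenation is a prefix of y, and these
   prefixes exhaust y.  In particular, if the total length of the words w n is
   finite, then no y is their infinite concatenation. *)
Definition infinite_concat (w : nat -> seq A) y : Prop :=
  (forall n, let u := flatten (mkseq w n) in u = mkseq y (size u)) /\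
  (forall k, exists n, (k <= size (flatten (mkseq w n)))%N).

Definition dill_map (theta : nat) (f : theta.-tuple A -> seq A) F : Prop :=
  (0 < theta)%N /\ forall x, infinite_concat (fun i => f (factor theta x i)) (F x).

(* The pick only provides some word from which to start the minimization; the
   default value 0 is used only when there is no word of length theta, which,
   for theta > 0, means that A is empty. *)
Definition lower_norm (theta : nat) (f : theta.-tuple A -> seq A) : nat :=
  if [pick u : theta.-tuple A] is Some u0
  then size (f [arg min_(u < u0) size (f u)]%N) else 0%N.

Lemma neq_index x y : x <> y -> exists i, x i != y i.
Proof.
move=> nxy; apply: contrapT => nex; apply: nxy; apply/funext => i.
by apply: contrapT => /eqP nxyi; apply: nex; exists i.
Qed.

Definition cantor_dist (R : realType) x y : R :=
  match pselect (x = y) with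
  | left _ => 0
  | right nxy => 2 ^- ex_minn (neq_index nxy)
  end.

End DillMaps.

Definition equicontinuous_map (R : realType) (T : Type) (d : T -> T -> R)
    (F : T -> T) : Prop :=
  forall eps : R, 0 < eps -> exists delta : R, 0 < delta /\
    forall x y : T, d x y < delta ->
      forall t : nat, d (iter t F x) (iter t F y) < eps.

(* Main.v *)
Require Import Defs.
From mathcomp Require Import all_boot all_order all_algebra.
From mathcomp Require Import boolp reals.

(** Two configurations that agree on their first k letters have the same first
    k.+1 - theta windows of width theta.  A dill map sends each window to a word
    of length at least its lower norm m, so the two images agree on their first
    m * (k.+1 - theta) letters ([dill_map_agree]).  When m >= 2 and
    k >= 2 * theta, this number is at least k: agreement on the first k letters
    survives one application of the map, hence all its iterations.  Since
    agreement on a prefix of length k.+1 means being at Cantor distance less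
    than 2 ^- k ([cantor_dist_lt]), the balls of radius 2 ^- k with k large are
    stable, which is a strong form of equicontinuity. *)

Import Order.TTheory GRing.Theory Num.Theory.

Lemma cantor_dist_lt (R : realType) (A : finType) (x y : nat -> A) (k : nat) :
  (cantor_dist R x y < 2 ^- k)%R <-> (forall i, i < k.+1 -> x i = y i).
Proof.
rewrite /cantor_dist; case: pselect => [->|nxy].
  by split=> // _; rewrite invr_gt0 exprn_gt0 ?ltr0n.
case: ex_minnP => m xm_neq m_min.
rewrite ltf_pV2 ?posrE ?exprn_gt0 ?ltr0n // ltr_eXn2l ?ltr1n //.
split=> [lt_km i le_ik|agr].
  apply/eqP; apply: contraLR lt_km => /m_min le_mi.
  by rewrite -leqNgt (leq_trans le_mi).
by rewrite ltnNge; apply: contra xm_neq => le_mk; apply/eqP/agr.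
Qed.

Lemma pow2_inv_lt (R : realType) (eps : R) :
  (0 < eps)%R -> exists N, (2 ^- N < eps)%R.
Proof.
move=> eps_gt0; exists (Num.bound eps^-1).
rewrite invf_plt ?posrE ?exprn_gt0 ?ltr0n //.
apply: lt_trans (archi_boundP _) _; first by rewrite invr_ge0 ltW.
by rewrite -natrX ltr_nat ltn_expl.
Qed.

Section DillMap.
Variables (A : finType) (theta : nat) (f : theta.-tuple A -> seq A).

Lemma lower_norm_le (u : theta.-tuple A) : lower_norm f <= size (f u).
Proof.
rewrite /lower_norm; case: pickP => [u0 _|//].
by case: arg_minnP => // v _; apply.
Qed.

Lemma size_flatten_lower_norm (w : nat -> theta.-tuple A) (n : nat) :
  lower_norm f * n <= size (flatten (mkseq (fun i => f (w i)) n)).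
Proof.
elim: n => [|n IHn]; first by rewrite muln0.
by rewrite mkseqS flatten_rcons size_cat mulnS addnC leq_add ?lower_norm_le.
Qed.

Lemma dill_map_agree (F : (nat -> A) -> nat -> A) (x y : nat -> A) (k : nat) :
  dill_map f F -> (forall i, i < k -> x i = y i) ->
  forall i, i < lower_norm f * (k.+1 - theta) -> F x i = F y i.
Proof.
move=> [_ Fconcat] agr i lt_i.
pose u z := flatten (mkseq (fun j => f (factor theta z j)) (k.+1 - theta)).
have equ : u x = u y.
  congr flatten; apply/eq_in_map => j; rewrite mem_iota /= add0n => lt_j.
  congr f; apply/eq_from_tnth => l; rewrite !tnth_mktuple; apply: agr.
  apply: (@leq_trans (j + theta)); first by rewrite ltn_add2l.
  by rewrite -ltnS addnC -ltn_subRL.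
(* F x and F y thus start with the same word, which is longer than i. *)
have lt_iu : i < size (u x) := leq_trans lt_i (size_flatten_lower_norm _ _).
have [/(_ (k.+1 - theta)) /= ux _] := Fconcat x.
have [/(_ (k.+1 - theta)) /= uy _] := Fconcat y.
rewrite -/(u x) in ux; rewrite -/(u y) -equ in uy.
by rewrite -(nth_mkseq (x i) (F x) lt_iu) -ux uy nth_mkseq.
Qed.

(** From length 2 * theta on, the windows lost at the end of a prefix are
    compensated by the doubling of its length. *)
Lemma iter_dill_map_agree (F : (nat -> A) -> nat -> A) (x y : nat -> A)
    (k t : nat) :
  dill_map f F -> 1 < lower_norm f -> 2 * theta <= k ->
  (forall i, i < k -> x i = y i) ->
  forall i, i < k -> iter t F x i = iter t F y i.
Proof.
move=> Fdill f_gt1 le_k agr; elim: t => [//|t IHt] i lt_ik /=.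
apply: (dill_map_agree _ _ _ _ Fdill IHt); apply: leq_trans lt_ik _.
apply: leq_trans (leq_mul f_gt1 (leqnn _)).
rewrite mulnBr leq_subRL; last first.
  by rewrite leq_mul2l ltnW // ltnS (leq_trans _ le_k) ?leq_pmull.
by rewrite [2 * k.+1]mul2n -addnn leq_add // ltnW.
Qed.

End DillMap.

Theorem proposition1 (R : realType) (A : finType)
  (F : (nat -> A) -> (nat -> A)) (theta : nat) (f : theta.-tuple A -> seq A) :
  dill_map f F -> (1 < lower_norm f)%N ->
  equicontinuous_map (@cantor_dist A R) F.
Proof.
move=> Fdill f_gt1 eps /pow2_inv_lt[N ltN].
pose k := maxn N (2 * theta).
exists (2 ^- k)%R; split; first by rewrite invr_gt0 exprn_gt0 ?ltr0n.
move=> x y /cantor_dist_lt agr t; apply: le_lt_trans ltN.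
apply: (@le_trans _ _ (2 ^- k)%R).
  apply/ltW/cantor_dist_lt.
  apply: (iter_dill_map_agree _ _ _ _ _ _ _ t Fdill f_gt1 _ agr).
  by rewrite leqW // leq_maxr.
by rewrite lef_pV2 ?posrE ?exprn_gt0 ?ltr0n // ler_eXn2l ?ltr1n ?leq_maxl.
Qed.
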